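(* Let $\mathbb{X}$ be $\mathbb{Z}^d$ ($d\in\mathbb{N}$) or $\mathbb{Z}^{\mathbb{N}}$, let $\mathcal{A}$ be a unital Banach algebra, let $\{p_n\}_{n\in\mathbb{N}}$ be a decreasing sequence in $(0,1]$ and $\{q_n\}_{n\in\mathbb{N}}$ an increasing sequence in $(0,1]$. Then the algebras $$\mathcal{S}^{\{p_n\}}(\mathbb{X},\mathcal{A})=\bigcap_{n\in\mathbb{N}}\ell^{p_n}_{\omega_n}(\mathbb{X},\mathcal{A})\quad\text{and}\quad \mathcal{E}^{\{q_n\}}(\mathbb{X},\mathcal{A})=\bigcup_{n\in\mathbb{N}}\ell^{q_n}_{\nu_n}(\mathbb{X},\mathcal{A}),$$ where $\omega_n(m)=(1+|m|)^n$ and $\nu_n(m)=e^{|m|/(n+1)}$ for $m\in\mathbb{X}$, are inverse-closed.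
   Context: $\mathbb{N}$ is the set of positive integers; $\mathbb{Z}^{\mathbb{N}}$ is the additive group of all finitely supported sequences of integers; $|m|$ denotes the Euclidean norm of $m\in\mathbb{X}$. $\mathcal{A}$ is complex, not necessarily commutative, with norm $\|\cdot\|$ and unit $1_{\mathcal A}$. A weight on $\mathbb{X}$ is a map $\omega:\mathbb{X}\to[1,\infty)$ with $\omega(x+y)\le\omega(x)\omega(y)$. For $0<p\le1$, $\ell^p_\omega(\mathbb{X},\mathcal{A})=\{f:\mathbb{X}\to\mathcal{A}:\sum_{x\in\mathbb{X}}\|f(x)\|^p\omega(x)^p<\infty\}$, an algebra under convolution $(f\star g)(x)=\sum_y f(x-y)g(y)$ with unit $\delta_0$ ($\delta_0(\mathbf 0)=1_{\mathcal A}$, zero elsewhere), contained in $\ell^1(\mathbb{X},\mathcal{A})$ (the case $p=1$, $\omega\equiv1$). Monotone sequences need not be strictly monotone; the case $\lim_np_n=0$ is excluded in the definition of $\mathcal{S}^{\{p_n\}}$. A subalgebra $\mathcal{X}$ of $\ell^1(\mathbb{X},\mathcal{A})$ is inverse-closed if every $f\in\mathcal{X}$ that is invertible in $\ell^1(\mathbb{X},\mathcal{A})$ is also invertible in $\mathcal{X}$ (equivalently: if $f\in\mathcal{X}$ and the Fourier transform $\widehat f(z)=\sum_{x\in\mathbb{X}}f(x)z^x$ is invertible in $\mathcal{A}$ for all $z\in\mathbb{T}^d$, resp. all $z\in\mathbb{T}^\infty=\{(z_1,z_2,\dots):|z_i|=1\}$, then $f$ is invertible in $\mathcal{X}$). 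*)

(* Defs.v *)
From HB Require Import structures.
From mathcomp Require Import all_boot all_order all_algebra.
From mathcomp Require Import finmap complex.
From mathcomp Require Import all_classical all_reals all_analysis.
From mathcomp Require Import showcase.summability.

Set Implicit Arguments.
Unset Strict Implicit.
Unset Printing Implicit Defensive.

Import Order.TTheory GRing.Theory Num.Theory.
Import numFieldNormedType.Exports.

Local Open Scope classical_set_scope.
Local Open Scope ring_scope.

(* Not an HB structure: the hierarchy has no join of rings and normed modules
   other than numDomainType. Neither `|1| = 1 nor 1 != 0 is required, so that
   the various conventions for unital Banach algebras are all covered. *)
Structure banachAlgType (K : numFieldType) := BanachAlgType {
  banach_space :> completeNormedModType K ;
  banach_one : banach_space ;
  banach_mul : banach_space -> banach_space -> banach_space ;
  banach_mulA : associative banach_mul ;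
  banach_mul1l : left_id banach_one banach_mul ;
  banach_mul1r : right_id banach_one banach_mul ;
  banach_mulDl : left_distributive banach_mul +%R ;
  banach_mulDr : right_distributive banach_mul +%R ;
  banach_scaleAl : forall (c : K) x y,
    c *: banach_mul x y = banach_mul (c *: x) y ;
  banach_scaleAr : forall (c : K) x y,
    c *: banach_mul x y = banach_mul x (c *: y) ;
  banach_normM : forall x y, `|banach_mul x y| <= `|x| * `|y|
}.

Definition finsupp_seq : {pred nat -> int} :=
  fun m => `[< finite_set [set i | m i != 0] >].

Lemma finsupp_seq_zmod_closed : zmod_closed finsupp_seq.
Proof.
split=> [|m n /asboolP fm /asboolP fn]; apply/asboolP.
  by apply: (sub_finite_set _ (finite_set0 nat)) => i /= /eqP.
have fmn : finite_set ([set i | m i != 0] `|` [set i | n i != 0]).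
  by rewrite finite_setU.
apply: sub_finite_set fmn => i /= mn0.
have [mi0|] := eqVneq (m i) 0; last by left.
by right; apply: contraNneq mn0 => ni0; rewrite !fctE mi0 ni0 subrr.
Qed.

HB.instance Definition _ :=
  GRing.isZmodClosed.Build (nat -> int) finsupp_seq finsupp_seq_zmod_closed.

(* Coordinates are indexed by nat, i.e. by n - 1 for n a positive integer. *)
Record int_finseq :=
  IntFinseq { finseq_val :> nat -> int; _ : finseq_val \in finsupp_seq }.

HB.instance Definition _ := [isSub for finseq_val].
HB.instance Definition _ := [Choice of int_finseq by <:].
HB.instance Definition _ := [SubChoice_isSubZmodule of int_finseq by <:].

Section euclidean_norms.
Variable R : realType.

Definition enorm_fin (d : nat) (m : 'rV[int]_d) : R :=
  Num.sqrt (\sum_(i < d) (m ord0 i)%:~R ^+ 2).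

Definition enorm_finseq (m : int_finseq) : R :=
  Num.sqrt (\sum_(i \in [set: nat]) ((m i)%:~R ^+ 2 : R)).

End euclidean_norms.

Section convolution_algebras.
Variables (R : realType) (A : banachAlgType R[i]) (X : zmodType).

Implicit Types (f g : X -> A) (S : set (X -> A)).

(* The norm of A takes its values in R[i]. *)
Definition rnorm (a : A) : R := complex.Re `|a|.

Definition ellp (p : R) (w : X -> R) : set (X -> A) :=
  [set f | (\esum_(x in [set: X]) (rnorm (f x) `^ p * w x `^ p)%:E < +oo)%E].

Definition ell1 : set (X -> A) := ellp 1 (fun=> 1).

(* [summability.sum] is the limit of the sums over finite subsets of X. *)
Definition convolve f g : X -> A :=
  fun x => summability.sum (fun y => banach_mul (f (x - y)) (g y)).

Definition delta0 : X -> A := fun x => if x == 0 then banach_one A else 0.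

Record is_subalgebra S : Prop := IsSubalgebra {
  subalg_ell1 : S `<=` ell1 ;
  subalg_unit : S delta0 ;
  subalg_add : forall f g, S f -> S g -> S (fun x => f x + g x) ;
  subalg_scale : forall (c : R[i]) f, S f -> S (fun x => c *: f x) ;
  subalg_conv : forall f g, S f -> S g -> S (convolve f g)
}.

Definition invertible_in S f : Prop :=
  exists2 g, S g & convolve f g = delta0 /\ convolve g f = delta0.

Definition inverse_closed S : Prop :=
  is_subalgebra S /\
  forall f, S f -> invertible_in ell1 f -> invertible_in S f.

Variable N : X -> R.

Definition omega (n : nat) (m : X) : R := (1 + N m) ^+ n.

Definition nu (n : nat) (m : X) : R := expR (N m / n.+1%:R).

(* The sequences are indexed by the positive integers; the value at 0 is
   never used. *)
Definition Salg (p : nat -> R) : set (X -> A) :=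
  \bigcap_(n in [set n | (0 < n)%N]) ellp (p n) (omega n).

Definition Ealg (q : nat -> R) : set (X -> A) :=
  \bigcup_(n in [set n | (0 < n)%N]) ellp (q n) (nu n).

End convolution_algebras.

Arguments Salg {R} A {X} N p.
Arguments Ealg {R} A {X} N q.

(* Main.v *)
(* An inverse [g] of [f] in [l^1] is itself shown to lie in the weighted space,
   with no spectral theory. Split [g = h + g'] with [h] finitely supported and
   [g'] small in [l^1], and put [r = f * g' = delta - f * h]; then [r] is small
   in [l^1], it lies in the weighted space, and [g = h + g * r]. Taking norms
   pointwise, this becomes [u <= v + u * a] between nonnegative functions on the
   group, so [u] is bounded by the sum over [k] of the [v * a^k], and it remains
   to see that the weighted norm of [v * a^k] decays geometrically. For finitely
   supported [a] this holds because [v * a^k] is supported on polynomially many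
   points, all at distance O(k), where the weight is [C exp (kappa k)] with
   [kappa] as small as needed; an error that is small in the weighted norm only
   perturbs the rate. Everything works over any abelian group with a nonnegative
   subadditive length. *)
Require Import Defs.
From mathcomp Require Import all_boot all_order all_algebra.
From mathcomp Require Import finmap complex.
From mathcomp Require Import all_classical all_reals all_analysis.
From mathcomp Require Import showcase.summability.
From mathcomp Require Import ring lra.

Set Implicit Arguments.
Unset Strict Implicit.
Unset Printing Implicit Defensive.

Import Order.TTheory GRing.Theory Num.Theory.
Import numFieldNormedType.Exports.

Local Open Scope classical_set_scope.
Local Open Scope ring_scope.

(** * Unordered sums of nonnegative extended reals *)

Section esum_extra.
Context {R : realType}.
Local Open Scope ereal_scope.

Lemma esum_swap (T1 T2 : choiceType) (a : T1 -> T2 -> \bar R) :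
  (forall i j, 0 <= a i j) ->
  \esum_(i in [set: T1]) \esum_(j in [set: T2]) a i j =
  \esum_(j in [set: T2]) \esum_(i in [set: T1]) a i j.
Proof.
move=> a0; rewrite !esum_esum//.
rewrite (@reindex_esum _ _ _ ([set: T1] `*`` (fun=> [set: T2])) _
  (fun k : T1 * T2 => (k.2, k.1)))//.
split=> //=.
  by move=> [x y] [x' y'] _ _ /= [-> ->].
by move=> [x y] _ /=; exists (y, x).
Qed.

Lemma esum_ge_term (T : choiceType) (a : T -> \bar R) i :
  a i <= \esum_(i in [set: T]) a i.
Proof. by apply: esum_ge; exists [set i] => //; rewrite fsbig_set1. Qed.

(** Comparing finite partial sums gives [le] for every nonnegative factor. For finite [c] the
    converse is [le] for the inverse factor; for infinite [c] a single nonzero term already makes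
    the left side infinite. *)
Lemma esumZl (T : choiceType) (c : \bar R) (a : T -> \bar R) :
  0 <= c -> (forall i, 0 <= a i) ->
  \esum_(i in [set: T]) (c * a i) = c * \esum_(i in [set: T]) a i.
Proof.
move=> c0 a0.
have le (k : \bar R) (b : T -> \bar R) : 0 <= k -> (forall i, 0 <= b i) ->
    \esum_(i in [set: T]) (k * b i) <= k * \esum_(i in [set: T]) b i.
  move=> k0 b0; apply: ge_ereal_sup => _ [F [finF _] <-].
  rewrite fsbig_finite//= -ge0_sume_distrr//; apply: lee_wpmul2l => //.
  by apply: esum_ge; exists F => //; rewrite fsbig_finite.
apply/eqP; rewrite eq_le le//=.
have [<-|c00] := eqVneq 0 c.
  by rewrite mul0e esum_ge0// => i _; rewrite mul0e.
have {c0 c00} : 0 < c by rewrite lt_def eq_sym c00.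
case: c => [r| |] // c0.
  have := le r^-1%:E (fun i => r%:E * a i).
  under eq_esum do rewrite muleA -EFinM mulVf ?gt_eqF// mul1e.
  move=> /(_ _ _)/(lee_wpmul2l (ltW c0)).
  rewrite muleA -EFinM mulfV ?gt_eqF// mul1e.
  apply; first by rewrite lee_fin invr_ge0 ltW.
  by move=> i; rewrite mule_ge0// ltW.
have [a00|/existsNP[i /eqP ai0]] := pselect (forall i, a i = 0).
  by rewrite [X in _ * X]esum1// mule0 esum_ge0// => i _; rewrite mule_ge0.
apply: (@le_trans _ _ (+oo * a i)).
  have aigt0 : 0 < a i by rewrite lt_def ai0/=.
  by rewrite (gt0_mulye aigt0) leey.
exact: esum_ge_term (fun i => +oo * a i) i.
Qed.

Lemma esum_translate (X : zmodType) (y : X) (a : X -> \bar R) :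
  \esum_(x in [set: X]) a (x - y)%R = \esum_(x in [set: X]) a x.
Proof.
rewrite [RHS](@reindex_esum _ _ _ [set: X] _ (fun x => x - y)%R)//.
split=> //; first by move=> u v _ _ /= /addIr.
by move=> x _ /=; exists (x + y)%R => //; rewrite addrK.
Qed.

(** Repetitions in [s] only weaken the bound, so support lists can be used without removing
    duplicates. *)
Lemma esum_le_size (T : choiceType) (s : seq T) (a : T -> \bar R) (B : R) :
  (0 <= B)%R -> (forall i, a i <= B%:E) -> (forall i, i \notin s -> a i = 0) ->
  \esum_(i in [set: T]) a i <= ((size s)%:R * B)%:E.
Proof.
move=> B0 aB s0; apply: ge_ereal_sup => _ [F [finF _] <-].
rewrite fsbig_finite//= (bigID (mem s))/= [X in _ + X]big1 ?adde0//.
rewrite -big_filter; set t := seq.filter _ _.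
apply: (@le_trans _ _ (\sum_(i <- t) B%:E)); first exact: lee_sum.
rewrite sumEFin lee_fin big_const_seq count_predT iter_addr_0.
rewrite -(mulr_natl B) ler_wpM2r// ler_nat uniq_leq_size ?filter_uniq//.
by move=> x; rewrite mem_filter => /andP[].
Qed.

End esum_extra.

(** * Subadditivity of the power p for 0 < p <= 1 *)

Section subadditivity.
Context {R : realType}.
Implicit Types p : R.

(** After division by x + y this is t <= t^p on [0, 1], applied to two fractions whose sum is 1. *)
Lemma powR_subadd p (x y : R) : 0 < p <= 1 -> 0 <= x -> 0 <= y ->
  (x + y) `^ p <= x `^ p + y `^ p.
Proof.
move=> /andP[p0 p1] x0 y0.
have [s0|s0] := eqVneq (x + y) 0.
  by rewrite s0 powR0 ?gt_eqF// addr_ge0 ?powR_ge0.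
have {}s0 : 0 < x + y by rewrite lt_def s0 addr_ge0.
have scale z : 0 <= z -> z <= x + y ->
    (x + y) `^ p * (z / (x + y)) <= z `^ p.
  move=> z0 zs; have -> : z `^ p = (x + y) `^ p * (z / (x + y)) `^ p.
    by rewrite -powRM ?divr_ge0 ?(ltW s0)// mulrC divfK ?gt_eqF.
  rewrite ler_wpM2l ?powR_ge0//.
  have [->|zn0] := eqVneq z 0; first by rewrite mul0r powR_ge0.
  apply: ger1_powR p1; rewrite divr_gt0//= ?ler_pdivrMr ?mul1r//.
  by rewrite lt_def zn0.
have -> : (x + y) `^ p =
    (x + y) `^ p * (x / (x + y)) + (x + y) `^ p * (y / (x + y)).
  by rewrite -mulrDr -mulrDl divff ?gt_eqF// mulr1.
by rewrite lerD// scale// ?lerDl ?lerDr.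
Qed.

Local Open Scope ereal_scope.

Lemma poweR_subadd p (x y : \bar R) : (0 < p <= 1)%R -> 0 <= x -> 0 <= y ->
  (x + y) `^ p <= x `^ p + y `^ p.
Proof.
move=> p01; have pn0 : p != 0%R by rewrite gt_eqF//; case/andP: p01.
move: x y => [x| |] [y| |]//.
- by rewrite !lee_fin; exact: powR_subadd.
- by move=> _ _; rewrite (@poweRyr _ p)// addey ?leey.
- by move=> _ _; rewrite (@poweRyr _ p)// addye ?leey.
- by move=> _ _; rewrite (@poweRyr _ p)// addye ?leey.
Qed.

Lemma poweR_sum_subadd (I : Type) (s : seq I) p (a : I -> \bar R) :
  (0 < p <= 1)%R -> (forall i, 0 <= a i) ->
  (\sum_(i <- s) a i) `^ p <= \sum_(i <- s) a i `^ p.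
Proof.
move=> p01 a0; have p0 : p != 0%R by rewrite gt_eqF//; case/andP: p01.
elim: s => [|i s IH]; first by rewrite !big_nil poweR0r.
rewrite !big_cons; apply: (le_trans (poweR_subadd p01 _ _)) => //.
  exact: sume_ge0.
exact: leeD.
Qed.

Lemma poweR_esum_subadd (T : choiceType) p (a : T -> \bar R) :
  (0 < p <= 1)%R -> (forall i, 0 <= a i) ->
  (\esum_(i in [set: T]) a i) `^ p <= \esum_(i in [set: T]) a i `^ p.
Proof.
move=> p01 a0; have p0 : (0 < p)%R by case/andP: p01.
have powK (x : \bar R) : 0 <= x -> (x `^ p) `^ p^-1 = x.
  by move=> x0; rewrite -poweRrM mulfV ?gt_eqF// poweRe1.
have powKV (x : \bar R) : 0 <= x -> (x `^ p^-1) `^ p = x.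
  by move=> x0; rewrite -poweRrM mulVf ?gt_eqF// poweRe1.
set B := esum _ (fun i => a i `^ p).
have B0 : 0 <= B by apply: esum_ge0 => i _; exact: poweR_ge0.
(* Taking p-th roots frees the supremum from the power, so that it is enough to bound each finite
   partial sum. *)
rewrite -(powKV B)//; apply: gt0_ler_poweR.
- exact: ltW.
- by rewrite in_itv/= leey esum_ge0.
- by rewrite in_itv/= leey poweR_ge0.
apply: ge_ereal_sup => _ [F [finF _] <-].
rewrite -(powK (\sum_(i \in F) a i)); last first.
  by rewrite fsbig_finite//= sume_ge0.
apply: gt0_ler_poweR.
- by rewrite invr_ge0 ltW.
- by rewrite in_itv/= leey poweR_ge0.
- by rewrite in_itv/= leey B0.
rewrite fsbig_finite//=; apply: le_trans (poweR_sum_subadd _ p01 a0) _.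
by apply: esum_ge; exists F => //; rewrite fsbig_finite.
Qed.

End subadditivity.

(** * Convolution and weighted p-sums of nonnegative functions on the group *)

Section convolution_of_nonnegative_functions.
Context {R : realType} {X : zmodType}.
Local Open Scope ereal_scope.
Implicit Types (u v a b : X -> \bar R) (W : X -> R) (p : R).

Definition econv u v : X -> \bar R :=
  fun x => \esum_(y in [set: X]) (u (x - y)%R * v y).

(** This is the p-th power of the weighted quasi-norm, with [W] in the role of w^p. Without the p-th
    root it is subadditive for p <= 1. *)
Definition pnorm p W u : \bar R := \esum_(x in [set: X]) (u x `^ p * (W x)%:E).

Lemma econv_ge0 u v : (forall x, 0 <= u x) -> (forall x, 0 <= v x) ->
  forall x, 0 <= econv u v x.
Proof. by move=> u0 v0 x; apply: esum_ge0 => y _; exact: mule_ge0. Qed.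

Lemma econv_le u u' v v' : (forall x, 0 <= u x) -> (forall x, 0 <= v x) ->
  (forall x, u x <= u' x) -> (forall x, v x <= v' x) ->
  forall x, econv u v x <= econv u' v' x.
Proof. by move=> u0 v0 uu' vv' x; apply: le_esum => y _; exact: lee_pmul. Qed.

Lemma econvDl u u' v : (forall x, 0 <= u x) -> (forall x, 0 <= u' x) ->
  (forall x, 0 <= v x) ->
  econv (fun x => u x + u' x) v = fun x => econv u v x + econv u' v x.
Proof.
move=> u0 u'0 v0; apply/funext => x.
rewrite /econv -esumD; try by move=> y _; exact: mule_ge0.
by apply: eq_esum => y _; rewrite ge0_muleDl.
Qed.

Lemma econvDr u v v' : (forall x, 0 <= u x) -> (forall x, 0 <= v x) ->
  (forall x, 0 <= v' x) ->
  econv u (fun x => v x + v' x) = fun x => econv u v x + econv u v' x.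
Proof.
move=> u0 v0 v'0; apply/funext => x.
rewrite /econv -esumD; try by move=> y _; exact: mule_ge0.
by apply: eq_esum => y _; rewrite ge0_muleDr.
Qed.

(** By Tonelli both sides equal the double sum of u(x - y - z) a(z) b(y), which is symmetric in the
    two right factors because the group is abelian. *)
Lemma econvAC u a b : (forall x, 0 <= u x) -> (forall x, 0 <= a x) ->
  (forall x, 0 <= b x) -> econv (econv u a) b = econv (econv u b) a.
Proof.
move=> u0 a0 b0; apply/funext => x; rewrite /econv.
transitivity (\esum_(y in [set: X]) \esum_(z in [set: X])
    (u (x - y - z)%R * a z * b y)).
  apply: eq_esum => y _; rewrite muleC -esumZl//.
    by apply: eq_esum => z _; rewrite muleC.
  by move=> z; exact: mule_ge0.
rewrite esum_swap; last by move=> y z; rewrite !mule_ge0.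
apply: eq_esum => z _; rewrite muleC -esumZl//.
  by apply: eq_esum => y _; rewrite [RHS]muleA [a z * _]muleC addrAC.
by move=> y; exact: mule_ge0.
Qed.

Lemma pnorm_ge0 p W u : (forall x, 0 <= W x)%R -> 0 <= pnorm p W u.
Proof.
by move=> W0; apply: esum_ge0 => x _; rewrite mule_ge0 ?poweR_ge0 ?lee_fin.
Qed.

Lemma pnorm_le p W W' u u' : (0 < p)%R -> (forall x, 0 <= u x) ->
  (forall x, u x <= u' x) ->
  (forall x, 0 <= W x)%R -> (forall x, W x <= W' x)%R ->
  pnorm p W u <= pnorm p W' u'.
Proof.
move=> p0 u0 uu' W0 WW'; apply: le_esum => x _.
apply: lee_pmul; rewrite ?poweR_ge0 ?lee_fin//.
apply: gt0_ler_poweR; rewrite ?in_itv/= ?leey ?andbT ?(ltW p0)//.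
exact: le_trans (uu' x).
Qed.

Lemma pnormD p W u v : (0 < p <= 1)%R -> (forall x, 0 <= W x)%R ->
  (forall x, 0 <= u x) -> (forall x, 0 <= v x) ->
  pnorm p W (fun x => u x + v x) <= pnorm p W u + pnorm p W v.
Proof.
move=> p01 W0 u0 v0; rewrite /pnorm -esumD; try by
  move=> x _; rewrite mule_ge0 ?poweR_ge0 ?lee_fin.
apply: le_esum => x _; rewrite -ge0_muleDl ?poweR_ge0//.
by apply: lee_wpmul2r; rewrite ?lee_fin// poweR_subadd.
Qed.

(** Subadditivity moves the power inside the convolution sum, W(x) <= W(x - y) W(y) distributes the
    weight, and Tonelli with translation invariance separates the factors. *)
Lemma pnorm_econv p W u v : (0 < p <= 1)%R -> (forall x, 0 <= W x)%R ->
  (forall x y, W (x + y) <= W x * W y)%R ->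
  (forall x, 0 <= u x) -> (forall x, 0 <= v x) ->
  pnorm p W (econv u v) <= pnorm p W u * pnorm p W v.
Proof.
move=> p01 W0 WM u0 v0; rewrite /pnorm /econv.
set U := fun x => u x `^ p * (W x)%:E; set V := fun x => v x `^ p * (W x)%:E.
have U0 x : 0 <= U x by rewrite mule_ge0 ?poweR_ge0 ?lee_fin.
have V0 x : 0 <= V x by rewrite mule_ge0 ?poweR_ge0 ?lee_fin.
apply: (@le_trans _ _ (\esum_(x in [set: X]) \esum_(y in [set: X])
    (U (x - y)%R * V y))).
  apply: le_esum => x _.
  apply: (@le_trans _ _ (\esum_(y in [set: X])
     ((W x)%:E * (u (x - y)%R * v y) `^ p))).
    rewrite esumZl ?lee_fin//; last by move=> y; exact: poweR_ge0.
    rewrite muleC lee_wpmul2l ?lee_fin//.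
    by apply: poweR_esum_subadd => // y; rewrite mule_ge0.
  apply: le_esum => y _; rewrite poweRM// /U /V muleACA [leRHS]muleC.
  rewrite lee_wpmul2r ?mule_ge0 ?poweR_ge0// -EFinM lee_fin.
  by rewrite -{1}(subrK y x).
rewrite esum_swap; last by move=> x y; rewrite mule_ge0.
rewrite -esumZl//; last by apply: esum_ge0 => x _; exact: U0.
apply: le_esum => y _; under eq_esum do rewrite muleC.
by rewrite esumZl// esum_translate muleC.
Qed.

End convolution_of_nonnegative_functions.

(** * Small tails of convergent sums *)

Section tails.
Context {R : realType} {T : choiceType}.
Local Open Scope ereal_scope.

Lemma esum_tail (a : T -> \bar R) (e : R) : (forall x, 0 <= a x) ->
  \esum_(x in [set: T]) a x < +oo -> (0 < e)%R ->
  exists s : {fset T},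
    \esum_(x in [set: T]) (if x \in s then 0 else a x) <= e%:E.
Proof.
move=> a0 aoo e0; have afin : \esum_(x in [set: T]) a x \is a fin_num.
  by rewrite ge0_fin_numE// esum_ge0.
have [_ [F [finF _] <-] Fe] := ub_ereal_sup_adherent e0 afin.
exists (fset_set F).
have FE : \sum_(x \in F) a x = \esum_(x in F) a x by rewrite esum_fset.
have := esumID F setT a (fun x _ => a0 x).
rewrite setTI -FE; set S := \esum_(x in _ `&` _) _ => aE.
have -> : \esum_(x in [set: T]) (if x \in fset_set F then 0 else a x) = S.
  rewrite /S setTI [RHS]esum_mkcond; apply: eq_esum => x _.
  by rewrite in_fset_set// in_setC; case: (x \in F).
have aux (f t : \bar R) : f + t \is a fin_num -> f + t - e%:E < f -> t <= e%:E.
  case: f => [f| |]//; case: t => [t| |]// _.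
  by rewrite lte_fin lee_fin; lra.
by apply: (aux (\sum_(x \in F) a x)); rewrite -aE.
Qed.

End tails.

(** * Comparison of polynomials with exponentials *)

Section exponential_bounds.
Context {R : realType}.

Lemma poly_le_expR (n : nat) (k : R) : 0 < k ->
  exists2 c : R, 0 <= c & forall t, 0 <= t -> (1 + t) ^+ n <= c * expR (k * t).
Proof.
(* The bound is the n-th power of 1 + t <= (1 + 1/h) exp(h t). Dividing by n + 1 keeps h defined and
   positive at n = 0 and still gives n h <= k. *)
move=> k0; pose h := k / n.+1%:R.
have h0 : 0 < h by rewrite divr_gt0.
have kE : k = n.+1%:R * h by rewrite /h mulrC divfK.
clearbody h.
exists ((1 + h^-1) ^+ n) => [|t t0].
  by rewrite exprn_ge0// addr_ge0// invr_ge0 ltW.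
have le1 : 1 + t <= (1 + h^-1) * expR (h * t).
  apply: (@le_trans _ _ ((1 + h^-1) * (1 + h * t))).
    have -> : (1 + h^-1) * (1 + h * t) = 1 + h * t + h^-1 + t.
      by field; rewrite gt_eqF.
    have : 0 <= h * t by rewrite mulr_ge0 ?(ltW h0).
    have : 0 <= h^-1 by rewrite invr_ge0 ltW.
    lra.
  rewrite ler_wpM2l ?expR_ge1Dx// addr_ge0// invr_ge0 ltW//.
apply: (@le_trans _ _ (((1 + h^-1) * expR (h * t)) ^+ n)).
  by rewrite lerXn2r// nnegrE ?mulr_ge0 ?expR_ge0 ?addr_ge0 ?invr_ge0 ?(ltW h0).
rewrite exprMn ler_wpM2l ?exprn_ge0 ?addr_ge0 ?invr_ge0 ?(ltW h0)//.
rewrite -expRM_natl ler_expR.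
by rewrite kE mulrA ler_wpM2r// ler_wpM2r ?(ltW h0)// ler_nat.
Qed.

Lemma expR_vanish (p Q e : R) : 0 < p -> 0 < e -> 0 <= Q ->
  exists K : nat, Q * expR (- (p * K%:R)) <= e.
Proof.
(* This K exceeds Q / (e p), and exp(p K) >= 1 + p K then gives Q <= e exp(p K). *)
move=> p0 e0 Q0; exists (Num.truncn (Q / (e * p))).+1.
set K := _.+1; have QK : Q <= e * expR (p * K%:R).
  apply: (@le_trans _ _ (e * (1 + p * K%:R))); last first.
    by rewrite ler_wpM2l ?expR_ge1Dx ?ltW.
  have : Q / (e * p) <= K%:R.
    by rewrite ltW// truncnS_gt.
  rewrite ler_pdivrMr ?mulr_gt0//; lra.
by rewrite expRN ler_pdivrMr ?expR_gt0.
Qed.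

End exponential_bounds.

(** * The iterates [iter k (econv^~ a) v], that is v * a^k, and Neumann series *)

Section iterated_convolution.
Context {R : realType} {X : zmodType}.
Local Open Scope ereal_scope.
Implicit Types (u v a b : X -> \bar R) (W : X -> R) (p : R).

Lemma iter_econv_ge0 a v k : (forall x, 0 <= a x) -> (forall x, 0 <= v x) ->
  forall x, 0 <= iter k (econv^~ a) v x.
Proof. by move=> a0 v0; elim: k => //= k IH; exact: econv_ge0. Qed.

Lemma iter_econvD a u v k : (forall x, 0 <= a x) -> (forall x, 0 <= u x) ->
  (forall x, 0 <= v x) ->
  iter k (econv^~ a) (fun x => u x + v x) =
  fun x => iter k (econv^~ a) u x + iter k (econv^~ a) v x.
Proof.
move=> a0 u0 v0; elim: k => //= k ->.
by rewrite econvDl//; exact: iter_econv_ge0.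
Qed.

Lemma iter_econvAC a b v k : (forall x, 0 <= a x) -> (forall x, 0 <= b x) ->
  (forall x, 0 <= v x) ->
  iter k (econv^~ a) (econv v b) = econv (iter k (econv^~ a) v) b.
Proof.
move=> a0 b0 v0; elim: k => //= k ->.
by rewrite econvAC//; exact: iter_econv_ge0.
Qed.

Lemma iter_econv_le a u v k : (forall x, 0 <= a x) -> (forall x, 0 <= u x) ->
  (forall x, u x <= v x) ->
  forall x, iter k (econv^~ a) u x <= iter k (econv^~ a) v x.
Proof.
move=> a0 u0 uv; elim: k => //= k IH x; apply: econv_le => //.
exact: iter_econv_ge0.
Qed.

Lemma esum_econv u v : (forall x, 0 <= u x) -> (forall x, 0 <= v x) ->
  \esum_(x in [set: X]) econv u v x =
  (\esum_(x in [set: X]) u x) * (\esum_(x in [set: X]) v x).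
Proof.
move=> u0 v0; rewrite /econv esum_swap; last by move=> x y; rewrite mule_ge0.
rewrite -esumZl//; last by apply: esum_ge0 => x _; exact: u0.
apply: eq_esum => y _; under eq_esum do rewrite muleC.
by rewrite esumZl// esum_translate muleC.
Qed.

Lemma esum_iter_econv a u k (H t : R) :
  (forall x, 0 <= a x) -> (forall x, 0 <= u x) ->
  \esum_(x in [set: X]) u x <= H%:E -> \esum_(x in [set: X]) a x <= t%:E ->
  \esum_(x in [set: X]) iter k (econv^~ a) u x <= (H * t ^+ k)%:E.
Proof.
move=> a0 u0 uH aT; elim: k => [|k IH]; first by rewrite mulr1.
rewrite iterS esum_econv//; last exact: iter_econv_ge0.
rewrite exprSr mulrA EFinM; apply: lee_pmul => //; apply: esum_ge0 => x _ //.
exact: iter_econv_ge0.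
Qed.

(** Induction on k for all v at once: v * (a + b)^(k+1) is the sum of (v * a) * (a + b)^k and (v *
    b) * (a + b)^k. The hypothesis passes to v * a with constant D t and to v * b with constant D
    eps. *)
Lemma pnorm_iter_perturb p W a b (eps t : R) : (0 < p <= 1)%R ->
  (forall x, 0 <= W x)%R -> (forall x y, W (x + y) <= W x * W y)%R ->
  (forall x, 0 <= a x) -> (forall x, 0 <= b x) ->
  pnorm p W b <= eps%:E ->
  forall k v (D : R), (forall x, 0 <= v x) ->
  (forall j, pnorm p W (iter j (econv^~ a) v) <= (D * t ^+ j)%:E) ->
  pnorm p W (iter k (econv^~ (fun x => a x + b x)) v) <=
    (D * (t + eps) ^+ k)%:E.
Proof.
move=> p01 W0 WM a0 b0 beps.
have ab0 x : 0 <= a x + b x by rewrite adde_ge0.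
elim=> [v D v0 /(_ 0%N)//|k IH v D v0 aD].
have va0 : forall x, 0 <= econv v a x by exact: econv_ge0.
have vb0 : forall x, 0 <= econv v b x by exact: econv_ge0.
rewrite iterSr econvDr// iter_econvD//.
apply: (le_trans (pnormD p01 W0 _ _)); try exact: iter_econv_ge0.
have -> : (D * (t + eps) ^+ k.+1 =
    D * t * (t + eps) ^+ k + D * eps * (t + eps) ^+ k)%R by rewrite exprS; ring.
rewrite EFinD; apply: leeD; apply: IH => // j.
  by rewrite -mulrA -exprS -iterSr; exact: aD.
rewrite iter_econvAC//.
apply: le_trans (pnorm_econv p01 W0 WM _ b0) _; first exact: iter_econv_ge0.
rewrite mulrAC EFinM; apply: lee_pmul => //; exact: pnorm_ge0.
Qed.

(** The inequality is substituted into its own last term K times, leaving the remainder u * a^K. *)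
Lemma neumann_le u v a K : (forall x, 0 <= u x) -> (forall x, 0 <= v x) ->
  (forall x, 0 <= a x) -> (forall x, u x <= v x + econv u a x) ->
  forall x, u x <= \sum_(k < K) iter k (econv^~ a) v x + iter K (econv^~ a) u x.
Proof.
move=> u0 v0 a0 uva; elim: K => [|K IH] x; first by rewrite big_ord0 add0e.
apply: (le_trans (IH x)); rewrite big_ord_recr/= -addeA leeD2l//.
have := iter_econv_le K a0 u0 uva x.
rewrite iter_econvD//; last exact: econv_ge0.
by rewrite iter_econvAC.
Qed.

(** No weighted bound on u is available to control the remainder u * a^K. On a fixed finite set,
    however, each of its values is at most its l^1 norm, hence at most G exp(-K), while the total
    weight of the set is fixed. The remainder therefore vanishes as K grows, and the geometric
    series gives a bound independent of the set. *)
Lemma pnorm_neumann_lty p W u v a (D s G : R) : (0 < p <= 1)%R ->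
  (forall x, 0 <= W x)%R -> (forall x, 0 <= u x) -> (forall x, 0 <= v x) ->
  (forall x, 0 <= a x) -> (forall x, u x <= v x + econv u a x) ->
  \esum_(x in [set: X]) u x <= G%:E ->
  \esum_(x in [set: X]) a x <= (expR (- 1))%:E ->
  (0 <= s < 1)%R -> (0 <= D)%R ->
  (forall k, pnorm p W (iter k (econv^~ a) v) <= (D * s ^+ k)%:E) ->
  pnorm p W u < +oo.
Proof.
move=> p01 W0 u0 v0 a0 uva uG a1 /andP[s0 s1] D0 vD.
have p0 : (0 < p)%R by case/andP: p01.
have G0 : (0 <= G)%R by rewrite -lee_fin (le_trans _ uG)// esum_ge0.
apply: (@le_lt_trans _ _ (D / (1 - s))%:E); last exact: ltry.
apply: ge_ereal_sup => _ [F [finF _] <-]; apply/lee_addgt0Pr => e e0.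
rewrite fsbig_finite//=; set f := fset_set F.
have S0 : (0 <= \sum_(x <- f) W x)%R by exact: sumr_ge0.
have Q0 : (0 <= G `^ p * \sum_(x <- f) W x)%R by rewrite mulr_ge0 ?powR_ge0.
(* K depends on the finite set F and on e, and makes the contribution of the remainder over F at
   most e. *)
have [K QK] := expR_vanish p0 e0 Q0.
apply: (@le_trans _ _ (\sum_(x <- f) (\sum_(k < K)
   (iter k (econv^~ a) v x) `^ p * (W x)%:E +
   ((G * expR (- 1) ^+ K) `^ p * W x)%:E))).
  apply: lee_sum => x _.
  rewrite EFinM -ge0_sume_distrl; last by move=> k _; exact: poweR_ge0.
  rewrite -ge0_muleDl ?lee_fin ?powR_ge0 ?sume_ge0//; last first.
    by move=> k _; exact: poweR_ge0.
  rewrite lee_wpmul2r ?lee_fin//.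
  apply: (@le_trans _ _ ((\sum_(k < K) iter k (econv^~ a) v x +
      (G * expR (- 1) ^+ K)%:E) `^ p)).
    apply: gt0_ler_poweR; rewrite ?in_itv/= ?leey ?andbT ?(ltW p0)//.
      rewrite adde_ge0 ?lee_fin ?mulr_ge0 ?exprn_ge0 ?expR_ge0//.
      by apply: sume_ge0 => k _; exact: iter_econv_ge0.
    apply: (le_trans (neumann_le K u0 v0 a0 uva x)); rewrite leeD2l//.
    apply: le_trans (esum_iter_econv K a0 u0 uG a1).
    exact: esum_ge_term (iter K (econv^~ a) u) x.
  apply: (le_trans (poweR_subadd p01 _ _)).
  - by apply: sume_ge0 => k _; exact: iter_econv_ge0.
  - by rewrite lee_fin mulr_ge0// exprn_ge0 ?expR_ge0.
  rewrite leeD2r//; apply: poweR_sum_subadd => // k.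
  exact: iter_econv_ge0.
rewrite big_split/= exchange_big/=; apply: leeD.
  apply: (@le_trans _ _ (\sum_(k < K) (D * s ^+ k)%:E)).
    apply: lee_sum => k _; apply: le_trans (vD k).
    by apply: esum_ge; exists F => //; rewrite fsbig_finite.
  rewrite sumEFin lee_fin -mulr_sumr ler_wpM2l//.
  have : ((1 - s) * (\sum_(i < K) s ^+ i) <= 1)%R.
    by rewrite -opprB mulNr -subrX1 opprB gerBl exprn_ge0.
  by rewrite mulrC -ler_pdivlMr ?subr_gt0// div1r.
rewrite sumEFin lee_fin -mulr_sumr.
apply: le_trans QK; rewrite powRM ?exprn_ge0 ?expR_ge0// mulrAC ler_wpM2l//.
by rewrite -expRM_natl -expRM ler_expR; lra.
Qed.

End iterated_convolution.

(** * Geometric decay for finitely supported kernels, and its perturbation *)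

Section finite_support.
Context {R : realType} {X : zmodType}.
Implicit Types (E F : seq X) (N : X -> R).

(* Contains [e + x_1 + ... + x_j] for all [e] in [E] and [x_1], ..., [x_j] in
   [F]. Its size is polynomial in [j] because only the multiplicities of the
   elements of [F] matter. *)
Fixpoint sumset (j : nat) E F : seq X :=
  if F is x :: F' then [seq x *+ i + y | i <- iota 0 j.+1, y <- sumset j E F']
  else E.

Lemma size_sumset j E F : size (sumset j E F) = (size E * j.+1 ^ size F)%N.
Proof.
elim: F => [|x F IH] /=; first by rewrite muln1.
by rewrite size_cat size_map size_allpairs size_iota IH expnS -mulSn mulnCA.
Qed.

Lemma sumsetP j E x F y :
  reflect (exists i z, [/\ (i <= j)%N, z \in sumset j E F & y = x *+ i + z])
          (y \in sumset j E (x :: F)).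
Proof.
apply: (iffP allpairsP) => [[[i z] [+ zF yE]]|[i [z [ij zF ->]]]].
  by rewrite mem_iota => ij; exists i, z.
by exists (i, z); split; rewrite // mem_iota.
Qed.

Lemma sumset0 E F y : y \in E -> y \in sumset 0 E F.
Proof.
move=> yE; elim: F => // x F IH; apply/sumsetP.
by exists 0%N, y; rewrite mulr0n add0r.
Qed.

Lemma sumset_sub j E F y : y \in sumset j E F -> y \in sumset j.+1 E F.
Proof.
elim: F y => // x F IH y /sumsetP[i [z [ij zF ->]]]; apply/sumsetP.
by exists i, z; split=> //; [exact: leqW|exact: IH].
Qed.

Lemma sumsetS j E F y x :
  y \in sumset j E F -> x \in F -> y + x \in sumset j.+1 E F.
Proof.
elim: F y => // t F IH y /sumsetP[i [z [ij zF ->]]].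
rewrite inE => /predU1P[->|xF]; apply/sumsetP.
  (* The multiplicity of the head grows by one, and the tail is only enlarged by the higher cap on
     multiplicities. *)
  exists i.+1, z; split=> //; first exact: sumset_sub.
  by rewrite mulrS addrAC [t + _]addrC.
by exists i, (z + x); split; rewrite ?addrA ?leqW//; exact: IH.
Qed.

Local Open Scope ereal_scope.

(** A point where v * a^j is nonzero is a sum of one point of E and j points of F, whence the factor
    j + 1 in the length bound. *)
Lemma iter_econv_support N (M : R) (a v : X -> \bar R) E F j x :
  (forall x y, N (x + y) <= N x + N y)%R ->
  (forall x, x \notin E -> v x = 0) -> (forall x, x \notin F -> a x = 0) ->
  (forall x, x \in E -> N x <= M)%R -> (forall x, x \in F -> N x <= M)%R ->
  iter j (econv^~ a) v x != 0 ->
  x \in sumset j E F /\ (N x <= M * j.+1%:R)%R.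
Proof.
move=> ND v0 a0 NE NF; elim: j x => [|j IH] x /=.
  have [xE _|xE] := boolP (x \in E); last by rewrite v0// eqxx.
  by rewrite sumset0// mulr1; split=> //; exact: NE.
set u := iter j _ v => unz.
have [y /eqP] : exists y, u (x - y)%R * a y <> 0.
  apply/existsNP => u0; move: unz; rewrite /econv esum1 ?eqxx//.
rewrite mule_eq0 negb_or => /andP[/IH[xyF Nxy] ay0].
have yF : y \in F by apply: contraNT ay0 => /a0 ->.
rewrite -(subrK y x); split; first exact: sumsetS.
apply: (le_trans (ND _ _)); rewrite -natr1 mulrDr mulr1.
by rewrite lerD// NF.
Qed.

(** The sum is at most the number of support points, times the p-th power of the l^1 bound H
    exp(-j), times the largest weight on the support. The first and last factors grow at rates k and
    k M, too slow to beat exp(-p j). The rate [k] is fixed before [W], so that a weight can be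
    chosen according to it. *)
Lemma pnorm_iter_finite_support (p : R) N (a v : X -> \bar R) E F :
  (0 < p <= 1)%R ->
  (forall x, 0 <= N x)%R -> (forall x y, N (x + y) <= N x + N y)%R ->
  (forall x, 0 <= a x) -> (forall x, 0 <= v x) ->
  (forall x, x \notin E -> v x = 0) -> (forall x, x \notin F -> a x = 0) ->
  \esum_(x in [set: X]) v x < +oo ->
  \esum_(x in [set: X]) a x <= (expR (- 1))%:E ->
  exists2 k : R, (0 < k)%R & forall (W : X -> R) (C : R),
    (forall x, 0 <= W x)%R -> (forall x, W x <= C * expR (k * N x))%R ->
    exists2 D : R, (0 <= D)%R & forall j,
      pnorm p W (iter j (econv^~ a) v) <= (D * expR (- (p / 2)) ^+ j)%:E.
Proof.
move=> p01 N0 ND a0 v0 vE aF voo a1; have p0 : (0 < p)%R by case/andP: p01.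
pose M : R := (\sum_(x <- E ++ F) N x)%R.
have M0 : (0 <= M)%R by exact: sumr_ge0.
have NM x : x \in E ++ F -> (N x <= M)%R.
  by move=> xEF; rewrite /M (big_rem x)//= lerDl sumr_ge0.
have NE x : x \in E -> (N x <= M)%R by move=> xE; rewrite NM// mem_cat xE.
have NF x : x \in F -> (N x <= M)%R by move=> xF; rewrite NM// mem_cat xF orbT.
(* Chosen so that k (M + 1) = p / 2: point count and weight together use up half of the decay rate
   p. *)
clearbody M; pose k := (p / (2 * (M + 1)))%R.
have M1 : (0 < M + 1)%R by lra.
have k0 : (0 < k)%R by rewrite divr_gt0// mulr_gt0.
have kE : (k * (M + 1) = p / 2)%R by rewrite /k; field; rewrite gt_eqF.
clearbody k; exists k => // W C W0 WC.
have C0 : (0 <= C)%R.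
  by have := le_trans (W0 0%R) (WC 0%R); rewrite pmulr_lge0// expR_gt0.
have [c c0 cP] := poly_le_expR (size F) k0.
have [H H0 vH] : exists2 H : R, (0 <= H)%R &
    \esum_(x in [set: X]) v x <= H%:E.
  have v0' : 0 <= \esum_(x in [set: X]) v x by apply: esum_ge0.
  exists (fine (\esum_(x in [set: X]) v x)); first exact: fine_ge0.
  by rewrite fineK// ge0_fin_numE.
(* The factor exp(k M) pays for the weight being evaluated at length M (j + 1) instead of M j. *)
exists ((size E)%:R * c * H `^ p * C * expR (k * M))%R => [|j].
  by rewrite !mulr_ge0 ?powR_ge0 ?expR_ge0.
have u0 : forall x, 0 <= iter j (econv^~ a) v x by exact: iter_econv_ge0.
have supp := iter_econv_support (j := j) ND vE aF NE NF.
set B := ((H * expR (- 1) ^+ j) `^ p * (C * expR (k * (M * j.+1%:R))))%R.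
have B0 : (0 <= B)%R by rewrite !mulr_ge0 ?powR_ge0 ?expR_ge0.
apply: (@le_trans _ _ ((size (sumset j E F))%:R * B)%:E).
  apply: esum_le_size => // x; last first.
    move=> xS; have [->|/supp[]] := eqVneq (iter j (econv^~ a) v x) 0.
      by rewrite poweR0r ?gt_eqF// mul0e.
    by rewrite (negbTE xS).
  have [->|/supp[_ Nx]] := eqVneq (iter j (econv^~ a) v x) 0.
    by rewrite poweR0r ?gt_eqF// mul0e lee_fin.
  rewrite EFinM; apply: lee_pmul; rewrite ?poweR_ge0 ?lee_fin//.
    rewrite -poweR_EFin; apply: gt0_ler_poweR;
      rewrite ?in_itv/= ?leey ?andbT ?(ltW p0)//.
      by rewrite lee_fin mulr_ge0 ?exprn_ge0 ?expR_ge0.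
    apply: le_trans (esum_iter_econv j a0 v0 vH a1).
    exact: esum_ge_term (iter j (econv^~ a) v) x.
  by apply: (le_trans (WC x)); rewrite ler_wpM2l// ler_expR ler_wpM2l// ltW.
rewrite lee_fin size_sumset natrM natrX.
have cj : (j.+1%:R ^+ size F <= c * expR (k * j%:R))%R.
  by rewrite -natr1 addrC; exact: cP.
apply: (@le_trans _ _ ((size E)%:R * (c * expR (k * j%:R)) * B)%R).
  by rewrite ler_wpM2r// ler_wpM2l.
rewrite /B powRM ?exprn_ge0 ?expR_ge0//.
rewrite -!expRM_natr -expRM.
have -> : (- (p / 2) * j%:R = k * j%:R + (- 1 * j%:R * p) + k * (M * j.+1%:R)
     - k * M)%R.
  have -> : (p = 2 * (k * (M + 1)))%R by rewrite kE; field.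
  by rewrite -natr1; field.
rewrite expRB !expRD le_eqVlt; apply/orP; left; apply/eqP; field.
by rewrite gt_eqF// expR_gt0.
Qed.

(** Split a into a finitely supported part, whose iterates decay at rate t < 1, and a tail that is
    small for [W0]. The splitting and [k] are settled before [W]; any [W] below [W0] keeps the tail
    small. *)
Lemma pnorm_neumann_finite_support (p : R) N (W0 : X -> R)
    (u v a : X -> \bar R) E :
  (0 < p <= 1)%R ->
  (forall x, 0 <= N x)%R -> (forall x y, N (x + y) <= N x + N y)%R ->
  (forall x, 0 <= W0 x)%R ->
  (forall x, 0 <= u x) -> (forall x, 0 <= v x) -> (forall x, 0 <= a x) ->
  (forall x, x \notin E -> v x = 0) ->
  \esum_(x in [set: X]) v x < +oo -> \esum_(x in [set: X]) u x < +oo ->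
  \esum_(x in [set: X]) a x <= (expR (- 1))%:E -> pnorm p W0 a < +oo ->
  (forall x, u x <= v x + econv u a x) ->
  exists2 k : R, (0 < k)%R & forall (W : X -> R) (C : R),
    (forall x, 0 <= W x)%R -> (forall x y, W (x + y) <= W x * W y)%R ->
    (forall x, W x <= W0 x)%R -> (forall x, W x <= C * expR (k * N x))%R ->
    pnorm p W u < +oo.
Proof.
move=> p01 N0 ND W00 u0 v0 a0 vE voo uoo a1 aoo uva.
have p0 : (0 < p)%R by case/andP: p01.
pose t : R := expR (- (p / 2)).
have t0 : (0 < t)%R by exact: expR_gt0.
have t1 : (t < 1)%R by rewrite expR_lt1; lra.
(* Half of the gap below 1, so that t + eps is still less than 1. *)
pose eps : R := ((1 - t) / 2)%R.
have eps0 : (0 < eps)%R by rewrite /eps; lra.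
have term0 x : 0 <= a x `^ p * (W0 x)%:E.
  by rewrite mule_ge0 ?poweR_ge0 ?lee_fin.
have [F Feps] := esum_tail term0 aoo eps0.
pose af x := if x \in F then a x else 0.
pose b x := if x \in F then 0 else a x.
have af0 x : 0 <= af x by rewrite /af; case: ifP.
have b0 x : 0 <= b x by rewrite /b; case: ifP.
have aE : a = fun x => af x + b x.
  by apply/funext => x; rewrite /af /b; case: ifP; rewrite ?adde0 ?add0e.
have afF x : x \notin (F : seq X) -> af x = 0 by rewrite /af => /negbTE ->.
have af1 : \esum_(x in [set: X]) af x <= (expR (- 1))%:E.
  by apply: le_trans a1; apply: le_esum => x _; rewrite aE leeDl.
have [k k0 kP] := pnorm_iter_finite_support p01 N0 ND af0 v0 vE afF voo af1.
exists k => // W C Wge0 WM WW0 WC.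
have [D D0 DP] := kP W C Wge0 WC.
have beps : pnorm p W b <= eps%:E.
  apply: le_trans Feps; apply: le_esum => x _; rewrite /b; case: ifP => _.
    by rewrite poweR0r ?gt_eqF// mul0e.
  by rewrite lee_wpmul2l ?poweR_ge0 ?lee_fin.
have uG : \esum_(x in [set: X]) u x <= (fine (\esum_(x in [set: X]) u x))%:E.
  by rewrite fineK// ge0_fin_numE// esum_ge0.
have s01 : (0 <= t + eps < 1)%R by rewrite /eps; lra.
apply: (pnorm_neumann_lty p01 Wge0 u0 v0 a0 uva uG a1 s01 D0).
by move=> j; rewrite aE; exact: (pnorm_iter_perturb p01 Wge0 WM af0 b0 beps).
Qed.

End finite_support.

(** * The real-valued norm on the Banach algebra and bilinearity of its product *)

Section real_norm.
Context {R : realType} {A : banachAlgType R[i]}.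
Implicit Types a b : A.

Lemma normE a : `|a| = (rnorm a)%:C%C.
Proof. by rewrite /rnorm RRe_real// ger0_real. Qed.

Lemma rnorm_ge0 a : 0 <= rnorm a.
Proof. by have := normr_ge0 a; rewrite normE lecR. Qed.

Lemma rnormD a b : rnorm (a + b) <= rnorm a + rnorm b.
Proof. by have := ler_normD a b; rewrite !normE -rmorphD/= lecR. Qed.

Lemma rnormM a b : rnorm (banach_mul a b) <= rnorm a * rnorm b.
Proof. by have := banach_normM a b; rewrite !normE -rmorphM/= lecR. Qed.

Lemma rnorm0 : rnorm (0 : A) = 0.
Proof. by rewrite /rnorm normr0. Qed.

Lemma rnormZ (c : R[i]) a : rnorm (c *: a) = complex.Re `|c| * rnorm a.
Proof.
have : `|c *: a| = `|c| * `|a| by exact: normrZ.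
have cE : `|c| = (complex.Re `|c|)%:C%C by rewrite RRe_real// ger0_real.
by rewrite !normE {1}cE -rmorphM => /complexI.
Qed.

Lemma rnorm_sum (I : Type) (s : seq I) (P : pred I) (F : I -> A) :
  rnorm (\sum_(i <- s | P i) F i) <= \sum_(i <- s | P i) rnorm (F i).
Proof.
elim/big_rec2: _ => [|i y x _ xy]; first by rewrite rnorm0.
by apply: (le_trans (rnormD _ _)); rewrite lerD2l.
Qed.

Lemma banach_mulBl a b c :
  banach_mul (a - b) c = banach_mul a c - banach_mul b c :> A.
Proof.
by apply/eqP; rewrite eq_sym subr_eq -banach_mulDl subrK.
Qed.

Lemma banach_mul0l a : banach_mul 0 a = 0 :> A.
Proof. by rewrite -[X in banach_mul X _](subrr (0 : A)) banach_mulBl subrr. Qed.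

Lemma banach_mul0r a : banach_mul a 0 = 0 :> A.
Proof.
by apply: (@addrI _ (banach_mul a 0)); rewrite -banach_mulDr !addr0.
Qed.

Lemma banach_mul_suml (I : Type) (s : seq I) (F : I -> A) a :
  banach_mul (\sum_(i <- s) F i) a = \sum_(i <- s) banach_mul (F i) a.
Proof.
elim: s => [|i s IH]; first by rewrite !big_nil banach_mul0l.
by rewrite !big_cons banach_mulDl IH.
Qed.

Lemma banach_mul_sumr (I : Type) (s : seq I) (F : I -> A) a :
  banach_mul a (\sum_(i <- s) F i) = \sum_(i <- s) banach_mul a (F i).
Proof.
elim: s => [|i s IH]; first by rewrite !big_nil banach_mul0r.
by rewrite !big_cons banach_mulDr IH.
Qed.

End real_norm.

(** * Unconditional sums in the Banach algebra *)

Section unconditional_sums.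
Context {R : realType} {A : banachAlgType R[i]} {T : choiceType}.
Implicit Types (F G : T -> A) (l : A).

(** Convergence along the net of finite subsets, with a real tolerance in place of the
    complex-valued norm. *)
Definition has_sum F l := forall e : R, 0 < e ->
  exists B : {fset T}, forall C : {fset T}, (B `<=` C)%fset ->
    rnorm (l - \sum_(i <- C) F i) <= e.

Lemma partial_sumE F (C : {fset T}) : partial_sum F C = \sum_(i <- C) F i.
Proof. by rewrite /partial_sum big_seq_fsetE. Qed.

Lemma has_sum_cvg F l : has_sum F l <-> partial_sum F @ totally --> l.
Proof.
have TF := @totally_filter T; split=> [Fl|].
  apply/cvgrPdist_le => e e0.
  have eE : e = (complex.Re e)%:C%C by rewrite RRe_real// gtr0_real.
  have re0 : 0 < complex.Re e by rewrite -ltcR -eE.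
  have [B BP] := Fl _ re0; exists B => // C /= BC.
  by rewrite partial_sumE normE eE lecR; exact: BP.
move=> /cvgrPdist_le Fl e e0.
have [|B _ BP] := Fl e%:C%C; first by rewrite ltcR.
by exists B => C BC; have := BP C BC; rewrite partial_sumE normE lecR.
Qed.

Lemma has_sum_sum F l : has_sum F l -> summability.sum F = l.
Proof.
have TF := @totally_filter T.
by move=> /has_sum_cvg; apply: cvg_lim; exact: norm_hausdorff.
Qed.

(** By completeness it suffices that the net of partial sums is Cauchy: past a finite set B, they
    differ from the sum over B by at most the tail of the norms. *)
Lemma summable_has_sum F :
  (\esum_(x in [set: T]) (rnorm (F x))%:E < +oo)%E ->
  has_sum F (summability.sum F).
Proof.
move=> Foo; have TF := @totally_filter T; apply/has_sum_cvg.
apply: cauchy_cvg; apply: cauchy_exP => e e0.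
have eE : e = (complex.Re e)%:C%C by rewrite RRe_real// gtr0_real.
have re0 : 0 < complex.Re e by rewrite -ltcR -eE.
have F0 x : (0 <= (rnorm (F x))%:E)%E by rewrite lee_fin rnorm_ge0.
have re20 : 0 < complex.Re e / 2 by rewrite divr_gt0.
have [B Be] := esum_tail F0 Foo re20.
exists (partial_sum F B); exists B => // C /= BC.
rewrite -ball_normE/= !partial_sumE distrC normE eE ltcR.
apply: (@le_lt_trans _ _ (complex.Re e / 2)); last by lra.
rewrite (big_fsetID _ (mem B) C)/= [X in X + _ - _](_ : _ = \sum_(i <- B) F i).
  rewrite addrAC subrr add0r; apply: (le_trans (rnorm_sum _ _ _)).
  rewrite -lee_fin; apply: le_trans Be; apply: esum_ge.
  pose D := [fset x in C | x \notin B]%fset.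
  exists [set` D] => //; rewrite fsbig_finite//= set_fsetK -sumEFin.
  rewrite big_seq [leRHS]big_seq; apply: lee_sum => x.
  by rewrite !inE => /andP[_ /negbTE ->].
congr (\sum_(i <- _) F i); congr enum_fset; apply/fsetP => x; rewrite !inE/=.
by case: (boolP (x \in B)) => [/(fsubsetP BC) ->|]; rewrite ?andbF.
Qed.

Lemma rnorm_sum_esum F :
  ((rnorm (summability.sum F))%:E <= \esum_(x in [set: T]) (rnorm (F x))%:E)%E.
Proof.
(* If the norms are not summable, the left side may be only a default value, but the right side is
   infinite. *)
have [Foo|] := boolP (\esum_(x in [set: T]) (rnorm (F x))%:E < +oo)%E;
  last by rewrite ltey negbK => /eqP ->; rewrite leey.
apply/lee_addgt0Pr => e e0.
have [B /(_ B (fsubset_refl _)) Be] := summable_has_sum Foo e0.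
apply: (@le_trans _ _ ((\sum_(i <- B) rnorm (F i))%:E + e%:E)%E).
  rewrite -EFinD lee_fin.
  rewrite -(subrK (\sum_(i <- B) F i) (summability.sum F)).
  apply: (le_trans (rnormD _ _)); rewrite addrC lerD//; exact: rnorm_sum.
rewrite leeD2r// -sumEFin; apply: esum_ge.
by exists [set` B] => //; rewrite fsbig_finite//= set_fsetK.
Qed.

Lemma has_sumD F G l k :
  has_sum F l -> has_sum G k -> has_sum (fun x => F x + G x) (l + k).
Proof.
move=> Fl Gk e e0; have e20 : 0 < e / 2 by rewrite divr_gt0.
have [B BP] := Fl _ e20; have [C CP] := Gk _ e20.
exists (B `|` C)%fset => D; rewrite fsubUset => /andP[BD CD].
rewrite big_split/= opprD addrACA; apply: (le_trans (rnormD _ _)).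
by have := BP D BD; have := CP D CD; lra.
Qed.

Lemma has_sum0 : has_sum (fun=> 0) 0.
Proof.
by move=> e e0; exists fset0 => C _; rewrite big1// subrr rnorm0 ltW.
Qed.

Lemma has_sum_bigsum (I : Type) (s : seq I) (F : I -> T -> A) (l : I -> A) :
  (forall i, has_sum (F i) (l i)) ->
  has_sum (fun x => \sum_(i <- s) F i x) (\sum_(i <- s) l i).
Proof.
move=> Fl; elim: s => [|i s IH].
  by rewrite big_nil; under eq_fun do rewrite big_nil; exact: has_sum0.
rewrite big_cons; under eq_fun do rewrite big_cons; exact: has_sumD.
Qed.

Lemma has_sum_mulr F l a :
  has_sum F l -> has_sum (fun x => banach_mul (F x) a) (banach_mul l a).
Proof.
move=> Fl e e0; have a0 := rnorm_ge0 a.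
(* Adding 1 keeps the denominator positive when a has norm zero. *)
have ea0 : 0 < e / (rnorm a + 1) by rewrite divr_gt0//; lra.
have [B BP] := Fl _ ea0; exists B => C /BP.
rewrite -banach_mul_suml -banach_mulBl ler_pdivlMr; last by lra.
set b := l - _ => be; apply: (le_trans (rnormM _ _)); apply: le_trans be.
by rewrite ler_wpM2l ?rnorm_ge0//; lra.
Qed.

Lemma has_sum_finite F (B : {fset T}) :
  (forall x, x \notin B -> F x = 0) -> has_sum F (\sum_(i <- B) F i).
Proof.
move=> F0 e e0; exists B => C BC.
rewrite (_ : \sum_(i <- C) F i = \sum_(i <- B) F i) ?subrr ?rnorm0 ?ltW//.
apply/esym/big_fset_incl => //.
by move=> x _ /F0.
Qed.

End unconditional_sums.

Lemma has_sum_translate (R : realType) (A : banachAlgType R[i]) (X : zmodType)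
    (F : X -> A) l (y : X) :
  has_sum F l -> has_sum (fun x => F (x - y)) l.
Proof.
move=> Fl e /Fl[B BP]; exists [fset (x + y)%R | x in B]%fset => C BC.
rewrite (_ : \sum_(i <- C) F (i - y) =
             \sum_(i <- [fset (x - y)%R | x in C]%fset) F i).
  apply: BP; apply/fsubsetP => x xB; apply/imfsetP; exists (x + y) => /=.
    by apply: (fsubsetP BC); apply/imfsetP; exists x.
  by rewrite addrK.
by rewrite big_imfset//= => u v _ _ /addIr.
Qed.

(** * Convolution of algebra-valued functions in l^1 *)

Section convolution.
Context {R : realType} {A : banachAlgType R[i]} {X : zmodType}.
Local Open Scope ereal_scope.
Implicit Types (f g h : X -> A) (w : X -> R) (p : R).

Definition enormf f : X -> \bar R := fun x => (rnorm (f x))%:E.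

Lemma enormf_ge0 f x : 0 <= enormf f x.
Proof. by rewrite lee_fin rnorm_ge0. Qed.
Hint Resolve enormf_ge0 : core.

Lemma ellpE p w f :
  ellp p w f = (pnorm p (fun x => w x `^ p)%R (enormf f) < +oo).
Proof. by []. Qed.

Lemma ell1E f : ell1 f = (\esum_(x in [set: X]) enormf f x < +oo).
Proof.
rewrite /ell1 /ellp/=; congr (is_true (_ < _)); apply: eq_esum => x _.
by rewrite powRr1 ?rnorm_ge0// powR1 mulr1.
Qed.

Lemma enormf_convolve_le f g x :
  enormf (convolve f g) x <= econv (enormf f) (enormf g) x.
Proof.
apply: (le_trans (rnorm_sum_esum _)); apply: le_esum => y _.
by rewrite -EFinM lee_fin rnormM.
Qed.

Lemma esum_convolve_le f g : \esum_(x in [set: X]) enormf (convolve f g) x <=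
  (\esum_(x in [set: X]) enormf f x) * (\esum_(x in [set: X]) enormf g x).
Proof.
rewrite -esum_econv//; apply: le_esum => x _; exact: enormf_convolve_le.
Qed.

Lemma ell1_convolve f g : ell1 f -> ell1 g -> ell1 (convolve f g).
Proof.
rewrite !ell1E => f1 g1; apply: le_lt_trans (esum_convolve_le f g) _.
by rewrite lte_mul_pinfty ?esum_ge0// ge0_fin_numE ?esum_ge0.
Qed.

(** The norms of the terms sum to at most one value of the scalar convolution, and that value is at
    most its total mass, the product of the two l^1 norms. *)
Lemma convolve_has_sum f g x : ell1 f -> ell1 g ->
  has_sum (fun y => banach_mul (f (x - y)%R) (g y)) (convolve f g x).
Proof.
rewrite !ell1E => f1 g1; apply: summable_has_sum.
apply: (@le_lt_trans _ _ (econv (enormf f) (enormf g) x)).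
  by apply: le_esum => y _; rewrite -EFinM lee_fin rnormM.
apply: (le_lt_trans (esum_ge_term (econv (enormf f) (enormf g)) x)).
rewrite esum_econv//.
by rewrite lte_mul_pinfty ?esum_ge0// ge0_fin_numE ?esum_ge0.
Qed.

Lemma convolveDr f g h : ell1 f -> ell1 g -> ell1 h ->
  convolve f (fun x => g x + h x)%R =
  fun x => (convolve f g x + convolve f h x)%R.
Proof.
move=> f1 g1 h1; apply/funext => x; apply: has_sum_sum.
under eq_fun do rewrite banach_mulDr.
by apply: has_sumD; exact: convolve_has_sum.
Qed.

Lemma convolve_finite_support f h (B : {fset X}) x :
  (forall y, y \notin B -> h y = 0%R) ->
  convolve f h x = (\sum_(y <- B) banach_mul (f (x - y)) (h y))%R.
Proof.
move=> h0; apply/has_sum_sum/has_sum_finite => y /h0 ->.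
exact: banach_mul0r.
Qed.

Lemma convolve_delta0r f : convolve f (@delta0 R A X) = f.
Proof.
apply/funext => x; rewrite (@convolve_finite_support _ _ [fset 0%R]%fset).
  by rewrite big_seq_fset1 /delta0 eqxx subr0 banach_mul1r.
by move=> y; rewrite inE /delta0 => /negbTE ->.
Qed.

Lemma convolve_delta0l h (B : {fset X}) :
  (forall y, y \notin B -> h y = 0%R) -> convolve (@delta0 R A X) h = h.
Proof.
move=> h0; apply/funext => x; rewrite (convolve_finite_support _ _ h0).
have [xB|xB] := boolP (x \in B).
  rewrite (big_fsetD1 x)//= subrr /delta0 eqxx banach_mul1l.
  rewrite big_seq big1 ?addr0// => y; rewrite !inE => /andP[yx _].
  by rewrite subr_eq0 eq_sym (negbTE yx) banach_mul0l.
rewrite h0// big_seq big1// => y yB; rewrite /delta0 subr_eq0.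
by case: eqP => [xy|_]; [rewrite xy yB in xB|rewrite banach_mul0l].
Qed.

(** With h finitely supported, the interchange is between one infinite sum and a finite one. For
    each y in the support, the inner series is that of (f * g)(x - y), translated by y. *)
Lemma convolveA_finite_support f g h (B : {fset X}) :
  (forall y, y \notin B -> h y = 0%R) -> ell1 f -> ell1 g ->
  convolve f (convolve g h) = convolve (convolve f g) h.
Proof.
move=> h0 f1 g1; apply/funext => x.
rewrite [RHS](convolve_finite_support _ _ h0); apply: has_sum_sum.
under eq_fun do rewrite (convolve_finite_support _ _ h0) banach_mul_sumr.
apply: has_sum_bigsum => y; under eq_fun do rewrite banach_mulA.
apply: has_sum_mulr.
have := has_sum_translate y (convolve_has_sum (x - y)%R f1 g1).
by under eq_fun do rewrite opprB addrA subrK.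
Qed.

End convolution.
#[global] Hint Resolve enormf_ge0 : core.

(** * Weighted l^p algebras and the weighted bound on inverses *)

Section weighted_algebras.
Context {R : realType} {A : banachAlgType R[i]} {X : zmodType}.
Local Open Scope ereal_scope.
Implicit Types (f g h : X -> A) (w : X -> R) (p q : R).

Definition is_weight w :=
  (forall x, 1 <= w x)%R /\ (forall x y, w (x + y) <= w x * w y)%R.

Lemma is_weight1 : is_weight (fun=> 1%R).
Proof. by split=> // x y; rewrite mulr1. Qed.

Lemma weight_ge0 w x : is_weight w -> (0 <= w x)%R.
Proof. by case=> w1 _; exact: le_trans (w1 x). Qed.

Lemma weight_powR_submult w p : (0 < p)%R -> is_weight w ->
  forall x y, (w (x + y) `^ p <= w x `^ p * w y `^ p)%R.
Proof.
move=> p0 ww x y; have w0 z := weight_ge0 z ww; case: ww => _ wM.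
rewrite -powRM//; apply: ge0_ler_powR; rewrite ?nnegrE ?mulr_ge0 ?(ltW p0)//.
Qed.

(** The terms t(x) of the p-sum are bounded by their sum S, so t^(q/p) <= S^(q/p - 1) t, and the
    q-sum is dominated by a multiple of the p-sum. *)
Lemma ellp_sub p q w w' : (0 < p)%R -> (p <= q)%R ->
  is_weight w' -> (forall x, w' x <= w x)%R ->
  @ellp R A X p w `<=` ellp q w'.
Proof.
move=> p0 pq ww' w'w f.
have w'0 x : (0 <= w' x)%R by exact: weight_ge0.
have w0 x : (0 <= w x)%R by exact: le_trans (w'w x).
have q0 : (0 < q)%R by exact: lt_le_trans pq.
rewrite /ellp/=.
pose t x := (rnorm (f x) `^ p * w x `^ p)%R.
have t0 x : (0 <= t x)%R by rewrite mulr_ge0 ?powR_ge0.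
set S := esum _ _ => Soo.
have S0 : 0 <= S by apply: esum_ge0 => x _; rewrite lee_fin t0.
have tS x : (t x <= fine S)%R.
  rewrite -lee_fin fineK ?ge0_fin_numE//.
  exact: (esum_ge_term (fun x => (t x)%:E)).
pose c := (fine S `^ (q / p - 1))%R.
apply: (@le_lt_trans _ _ (c%:E * S)); last first.
  by rewrite lte_mul_pinfty ?lee_fin ?powR_ge0.
have c0 : 0 <= c%:E by rewrite lee_fin powR_ge0.
rewrite -(esumZl c0 (fun x => t0 x : 0 <= (t x)%:E)).
apply: le_esum => x _; rewrite -EFinM lee_fin -/(t x).
apply: (@le_trans _ _ (t x `^ (q / p))%R).
  rewrite /t -!powRM ?rnorm_ge0// -powRrM [(p * _)%R]mulrC divfK ?gt_eqF//.
  apply: ge0_ler_powR; rewrite ?nnegrE ?mulr_ge0 ?rnorm_ge0 ?(ltW q0)//.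
  by rewrite ler_wpM2l ?rnorm_ge0.
rewrite -mulr_powRB1 ?divr_gt0// mulrC ler_wpM2r//.
apply: ge0_ler_powR; rewrite ?nnegrE ?fine_ge0//.
by rewrite subr_ge0 ler_pdivlMr ?mul1r.
Qed.

Lemma pnorm_finite_support p (W : X -> R) f (B : {fset X}) : (0 < p)%R ->
  (forall x, 0 <= W x)%R -> (forall x, x \notin B -> f x = 0%R) ->
  pnorm p W (enormf f) < +oo.
Proof.
move=> p0 W0 f0; pose t x := (rnorm (f x) `^ p * W x)%R.
have t0 x : (0 <= t x)%R by rewrite mulr_ge0 ?powR_ge0.
have tz x : x \notin B -> t x = 0%R.
  by move=> /f0 fx; rewrite /t fx rnorm0 powR0 ?gt_eqF// mul0r.
have S0 : (0 <= \sum_(x <- B) t x)%R by exact: sumr_ge0.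
apply: le_lt_trans (ltry ((size B)%:R * \sum_(x <- B) t x)%R).
apply: (esum_le_size (a := fun x => (t x)%:E)) => // x; last by move=> /tz ->.
rewrite lee_fin; have [xB|/tz ->//] := boolP (x \in B).
by rewrite (big_fsetD1 x)//= lerDl sumr_ge0.
Qed.

Lemma ell1_finite_support f (B : {fset X}) :
  (forall x, x \notin B -> f x = 0%R) -> ell1 f.
Proof.
move=> f0; rewrite /ell1 ellpE.
by apply: (pnorm_finite_support _ _ f0) => // x; exact: powR_ge0.
Qed.

Lemma ellp_subalgebra p w : (0 < p <= 1)%R -> is_weight w ->
  is_subalgebra (@ellp R A X p w).
Proof.
move=> p01 ww; have /andP[p0 p1] := p01.
have W0 x : (0 <= w x `^ p)%R by exact: powR_ge0.
have WM := weight_powR_submult p0 ww.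
split.
- by apply: ellp_sub => //; [exact: is_weight1|case: ww].
- rewrite ellpE; apply: (@pnorm_finite_support _ _ _ [fset 0%R]%fset) => //.
  by move=> x; rewrite inE /delta0 => /negbTE ->.
- move=> f g; rewrite !ellpE => fp gp.
  apply: le_lt_trans (lte_add_pinfty fp gp).
  apply: le_trans (pnormD p01 W0 _ _) => //; apply: pnorm_le => // x.
  by rewrite -EFinD lee_fin rnormD.
- move=> c f; rewrite !ellpE => fp; set k := complex.Re `|c|%R.
  have k0 : (0 <= k)%R by have := normr_ge0 c; rewrite lecE => /andP[].
  rewrite (_ : pnorm _ _ _ =
      (k `^ p)%:E * pnorm p (fun x => w x `^ p)%R (enormf f)).
    by rewrite lte_mul_pinfty ?lee_fin ?powR_ge0.
  have kp0 : 0 <= (k `^ p)%:E by rewrite lee_fin powR_ge0.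
  rewrite -(esumZl kp0); last by move=> x; rewrite mule_ge0 ?poweR_ge0 ?lee_fin.
  apply: eq_esum => x _; rewrite muleA; congr (_ * _).
  by rewrite /enormf rnormZ -EFinM/= powRM ?rnorm_ge0.
- move=> f g; rewrite !ellpE => fp gp.
  apply: (@le_lt_trans _ _ (pnorm p (fun x => w x `^ p)%R (enormf f) *
    pnorm p (fun x => w x `^ p)%R (enormf g))).
    apply: le_trans (pnorm_econv p01 W0 WM _ _) => //.
    by apply: pnorm_le => // x; exact: enormf_convolve_le.
  by rewrite lte_mul_pinfty ?pnorm_ge0// ge0_fin_numE ?pnorm_ge0.
Qed.

(** The rate [k] depends on f and g, so the target weight [w'] is quantified after it. A polynomial
    weight allows w' = w, whereas an exponential weight may have to be replaced by one of slower
    growth. *)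
Lemma ellp_inverse p (N w : X -> R) f g :
  (0 < p <= 1)%R -> is_weight w ->
  (forall x, 0 <= N x)%R -> (forall x y, N (x + y) <= N x + N y)%R ->
  ellp p w f -> ell1 g ->
  convolve f g = @delta0 R A X -> convolve g f = @delta0 R A X ->
  exists2 k : R, (0 < k)%R & forall (w' : X -> R) (C : R),
    is_weight w' -> (forall x, w' x <= w x)%R ->
    (forall x, w' x <= C * expR (k * N x))%R -> ellp p w' g.
Proof.
move=> p01 ww N0 ND fp g1 fg gf; have /andP[p0 p1] := p01.
have [sub1 unit_p _ _ conv_p] := ellp_subalgebra p01 ww.
have f1 : ell1 f by exact: sub1.
have W0 x : (0 <= w x `^ p)%R by exact: powR_ge0.
pose Hf := fine (\esum_(x in [set: X]) enormf f x).
have HfE : \esum_(x in [set: X]) enormf f x = Hf%:E.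
  by rewrite fineK// ge0_fin_numE ?esum_ge0// -ell1E.
have Hf0 : (0 <= Hf)%R by rewrite -lee_fin -HfE esum_ge0.
(* With this bound on the tail g', the product f * g' has l^1 norm at most exp(-1); adding 1 guards
   against Hf = 0. *)
clearbody Hf; pose e := (expR (- 1) / (Hf + 1))%R.
have e0 : (0 < e)%R by rewrite divr_gt0 ?expR_gt0//; lra.
have Hfe : (Hf * e <= expR (- 1))%R.
  rewrite /e mulrCA ler_piMr ?expR_ge0// ler_pdivrMr; lra.
have [F Fe] : exists F : {fset X},
    \esum_(x in [set: X]) (if x \in F then 0 else enormf g x) <= e%:E.
  by apply: esum_tail => //; rewrite -ell1E.
pose h x := if x \in F then g x else 0%R.
pose g' x := if x \in F then 0%R else g x.
have gE : g = fun x => (h x + g' x)%R.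
  by apply/funext => x; rewrite /h /g'; case: ifP; rewrite ?addr0 ?add0r.
have hF x : x \notin F -> h x = 0%R by rewrite /h => /negbTE ->.
have g'e : \esum_(x in [set: X]) enormf g' x <= e%:E.
  apply: le_trans Fe; apply: le_esum => x _; rewrite /enormf /g'.
  by case: ifP => //; rewrite rnorm0.
have h1 : ell1 h by exact: ell1_finite_support hF.
have g'1 : ell1 g' by rewrite ell1E (le_lt_trans g'e) ?ltry.
pose r := convolve f g'.
have fhr : (fun x => convolve f h x + r x)%R = @delta0 R A X.
  by rewrite -convolveDr// -gE.
have r1 : \esum_(x in [set: X]) enormf r x <= (expR (- 1))%:E.
  apply: le_trans (esum_convolve_le f g') _; rewrite HfE.
  apply: (@le_trans _ _ (Hf%:E * e%:E)); first by rewrite lee_wpmul2l ?lee_fin.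
  by rewrite -EFinM lee_fin.
(* Convolve delta = f * h + r with g on the left: g = (g * f) * h + g * r, and g * f = delta. *)
have ghr : g = fun x => (h x + convolve g r x)%R.
  have := convolveDr g1 (ell1_convolve f1 h1) (ell1_convolve f1 g'1).
  rewrite -/r fhr convolve_delta0r (convolveA_finite_support hF)// gf.
  by rewrite (convolve_delta0l hF).
(* Nothing is known about g' in the weighted space, but r = delta - f * h with h finitely supported
   and f in the space. *)
have rp : ellp p w r.
  have hp : ellp p w (convolve f h).
    by apply: conv_p => //; rewrite ellpE; exact: pnorm_finite_support hF.
  have -> : r = fun x => (@delta0 R A X x + (- 1) *: convolve f h x)%R.
    apply/funext => x; rewrite -fhr scaleN1r addrAC subrr add0r//.
  have [_ _ add_p scale_p _] := ellp_subalgebra p01 ww.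
  by apply: add_p => //; exact: scale_p.
have gle x : enormf g x <= enormf h x + econv (enormf g) (enormf r) x.
  rewrite {1}ghr; apply: (@le_trans _ _ (enormf h x + enormf (convolve g r) x)).
    by rewrite -EFinD lee_fin rnormD.
  by rewrite leeD2l// enormf_convolve_le.
have hF' x : x \notin (F : seq X) -> enormf h x = 0.
  by move=> /hF hx; rewrite /enormf hx rnorm0.
have hoo : \esum_(x in [set: X]) enormf h x < +oo by rewrite -ell1E.
have goo : \esum_(x in [set: X]) enormf g x < +oo by rewrite -ell1E.
have [k k0 kP] := pnorm_neumann_finite_support (W0 := fun x => (w x `^ p)%R)
  p01 N0 ND W0 (enormf_ge0 g) (enormf_ge0 h) (enormf_ge0 r) hF'
  hoo goo r1 rp gle.
exists k => // w' C ww' w'w w'C; rewrite ellpE.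
have w'0 x : (0 <= w' x)%R by exact: weight_ge0.
apply: (kP _ C) => [x|x y|x|x].
- exact: powR_ge0.
- exact: weight_powR_submult.
- by apply: ge0_ler_powR; rewrite ?nnegrE ?(ltW p0) ?(weight_ge0 _ ww).
(* Since w' >= 1 and p <= 1, w'^p <= w', so the same C and k serve for the p-th power. *)
- by apply: le_trans (w'C x); apply: ler1_powR p1; case: ww'.
Qed.

Lemma is_subalgebra_bigcap (I : Type) (D : set I) (S : I -> set (X -> A)) :
  D !=set0 -> (forall i, D i -> is_subalgebra (S i)) ->
  is_subalgebra (\bigcap_(i in D) S i).
Proof.
move=> [i0 Di0] SI; split.
- by move=> f /(_ i0 Di0); apply: subalg_ell1; exact: SI.
- by move=> i Di; apply: subalg_unit; exact: SI.
- by move=> f g fS gS i Di; apply: subalg_add; [exact: SI|exact: fS|exact: gS].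
- by move=> c f fS i Di; apply: subalg_scale; [exact: SI|exact: fS].
- by move=> f g fS gS i Di; apply: subalg_conv; [exact: SI|exact: fS|exact: gS].
Qed.

(** The family increases along D, so two members of the union lie in a common [S i], where sums and
    products can be formed. *)
Lemma is_subalgebra_bigcup (D : set nat) (S : nat -> set (X -> A)) :
  D !=set0 -> (forall i, D i -> is_subalgebra (S i)) ->
  (forall i j, D i -> (i <= j)%N -> D j /\ S i `<=` S j) ->
  is_subalgebra (\bigcup_(i in D) S i).
Proof.
move=> [i0 Di0] SI SM.
have join f g : (\bigcup_(i in D) S i) f -> (\bigcup_(i in D) S i) g ->
    exists2 i, D i & S i f /\ S i g.
  move=> [i Di fi] [j Dj gj].
  have [Dm Sim] := SM _ _ Di (leq_maxl i j).
  have [_ Sjm] := SM _ _ Dj (leq_maxr i j).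
  by exists (maxn i j) => //; split; [exact: Sim|exact: Sjm].
split.
- by move=> f [i Di]; apply: subalg_ell1; exact: SI.
- by exists i0 => //; apply: subalg_unit; exact: SI.
- move=> f g fS gS; have [i Di [fi gi]] := join _ _ fS gS.
  by exists i => //; apply: subalg_add => //; exact: SI.
- by move=> c f [i Di fi]; exists i => //; apply: subalg_scale => //; exact: SI.
- move=> f g fS gS; have [i Di [fi gi]] := join _ _ fS gS.
  by exists i => //; apply: subalg_conv => //; exact: SI.
Qed.

End weighted_algebras.

(** * Triangle inequality for the Euclidean norms *)

Section euclidean_length.
Context {R : realType}.

Lemma sqrt_minkowski (x y a b : R) :
  Num.sqrt ((x + y) ^+ 2 + (a + b) ^+ 2) <=
  Num.sqrt (x ^+ 2 + a ^+ 2) + Num.sqrt (y ^+ 2 + b ^+ 2).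
Proof.
set P := Num.sqrt (x ^+ 2 + _); set Q := Num.sqrt (y ^+ 2 + _).
have P0 : 0 <= P by exact: sqrtr_ge0.
have Q0 : 0 <= Q by exact: sqrtr_ge0.
have PE : P ^+ 2 = x ^+ 2 + a ^+ 2 by rewrite sqr_sqrtr// addr_ge0 ?sqr_ge0.
have QE : Q ^+ 2 = y ^+ 2 + b ^+ 2 by rewrite sqr_sqrtr// addr_ge0 ?sqr_ge0.
clearbody P Q.
(* Cauchy-Schwarz in the plane, from the identity (x^2 + a^2)(y^2 + b^2) - (x y + a b)^2 = (x b - y
   a)^2. *)
have cs : x * y + a * b <= P * Q.
  rewrite leNgt; apply/negP => lt.
  have : (P * Q) ^+ 2 < (x * y + a * b) ^+ 2.
    by rewrite ltrXn2r// ?nnegrE ?mulr_ge0// (le_trans _ (ltW lt)) ?mulr_ge0.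
  rewrite exprMn PE QE; apply/negP; rewrite -leNgt -subr_ge0.
  rewrite (_ : _ - _ = (x * b - y * a) ^+ 2) ?sqr_ge0//; ring.
rewrite -(ger0_norm (addr_ge0 P0 Q0)) -sqrtr_sqr ler_wsqrtr//.
have -> : (P + Q) ^+ 2 = P ^+ 2 + Q ^+ 2 + 2 * (P * Q) by ring.
rewrite PE QE; lra.
Qed.

Lemma sqrt_sum_minkowski (I : Type) (s : seq I) (u v : I -> R) :
  Num.sqrt (\sum_(i <- s) (u i + v i) ^+ 2) <=
  Num.sqrt (\sum_(i <- s) u i ^+ 2) + Num.sqrt (\sum_(i <- s) v i ^+ 2).
Proof.
elim: s => [|i s IH]; first by rewrite !big_nil sqrtr0 addr0.
have sq (w : I -> R) :
    \sum_(j <- s) w j ^+ 2 = Num.sqrt (\sum_(j <- s) w j ^+ 2) ^+ 2.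
  by rewrite sqr_sqrtr// sumr_ge0// => j _; exact: sqr_ge0.
(* Each remaining sum is viewed as the square of one real coordinate, its own norm, which reduces
   the step to the plane. *)
rewrite !big_cons (sq u) (sq v) (sq (fun j => u j + v j)).
apply: le_trans (sqrt_minkowski _ _ _ _); rewrite ler_wsqrtr// lerD2l.
by rewrite lerXn2r// ?nnegrE ?addr_ge0 ?sqrtr_ge0.
Qed.

Lemma enorm_finD d (x y : 'rV[int]_d) :
  enorm_fin R (x + y) <= enorm_fin R x + enorm_fin R y.
Proof.
rewrite /enorm_fin; apply: le_trans (sqrt_sum_minkowski _ _ _).
by under eq_bigr do rewrite mxE rmorphD/=.
Qed.

(** Any finite set containing the support may serve as [s], so that two sequences and their sum can
    be measured over a common set. *)
Lemma enorm_finseqE (m : int_finseq) (s : {fset nat}) :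
  (forall i, i \notin s -> m i = 0) ->
  enorm_finseq R m = Num.sqrt (\sum_(i <- s) (m i)%:~R ^+ 2).
Proof.
move=> m0; rewrite /enorm_finseq; congr Num.sqrt.
rewrite -(fsbig_widen [set` s] [set: nat]) ?fsbig_finite//= ?set_fsetK//.
by move=> i /= [_ /negP /m0 ->]; rewrite expr0n.
Qed.

Lemma int_finseq_support (m : int_finseq) :
  exists s : {fset nat}, forall i, i \notin s -> m i = 0.
Proof.
case: m => m /= mP; have /asboolP fm := mP.
exists (fset_set [set i | m i != 0]) => i.
by apply: contraNeq => mi0; rewrite in_fset_set// inE.
Qed.

Lemma enorm_finseqD (x y : int_finseq) :
  enorm_finseq R (x + y) <= enorm_finseq R x + enorm_finseq R y.
Proof.
have [s xs] := int_finseq_support x; have [t yt] := int_finseq_support y.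
have xst i : i \notin (s `|` t)%fset -> x i = 0.
  by rewrite inE negb_or => /andP[/xs].
have yst i : i \notin (s `|` t)%fset -> y i = 0.
  by rewrite inE negb_or => /andP[_ /yt].
have xyE i : (x + y) i = x i + y i by [].
rewrite (enorm_finseqE xst) (enorm_finseqE yst).
rewrite (@enorm_finseqE _ (s `|` t)%fset).
  apply: le_trans (sqrt_sum_minkowski _ _ _).
  by under eq_bigr do rewrite xyE rmorphD/=.
by move=> i ist; rewrite xyE xst// yst.
Qed.

End euclidean_length.

(** * Inverse-closedness for an arbitrary nonnegative subadditive length *)

Section inverse_closedness.
Context {R : realType} (A : banachAlgType R[i]) {X : zmodType} (N : X -> R).
Context (N0 : forall x, 0 <= N x) (ND : forall x y, N (x + y) <= N x + N y).

Lemma omega_weight n : is_weight (omega N n).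
Proof.
split=> [x|x y]; rewrite /omega; first by rewrite exprn_ege1// lerDl.
rewrite -exprMn lerXn2r ?nnegrE ?mulr_ge0 ?addr_ge0//.
have := ND x y; have := mulr_ge0 (N0 x) (N0 y).
rewrite mulrDl mul1r mulrDr mulr1; lra.
Qed.

Lemma nu_weight n : is_weight (nu N n).
Proof.
split=> [x|x y]; rewrite /nu; first by rewrite -expR0 ler_expR divr_ge0.
by rewrite -expRD ler_expR -mulrDl ler_wpM2r// invr_ge0.
Qed.

Lemma nu_le m n x : (m <= n)%N -> nu N n x <= nu N m x.
Proof.
move=> mn; rewrite ler_expR ler_wpM2l// lef_pV2 ?posrE ?ltr0n//.
by rewrite ler_nat ltnS.
Qed.

(** Each level n is treated on its own with w' = w: the polynomial weight [omega N n] lies below a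
    multiple of exp(k N) for every k > 0. *)
Lemma Salg_inverse_closed (p : nat -> R) :
  (forall n, (0 < n)%N -> 0 < p n <= 1) -> inverse_closed (Salg A N p).
Proof.
move=> p01; split.
  apply: is_subalgebra_bigcap => [|n n0]; first by exists 1%N.
  by apply: ellp_subalgebra; [exact: p01|exact: omega_weight].
move=> f fS [g g1 [fg gf]]; exists g => // n n0.
have [k k0] :=
  ellp_inverse (p01 n n0) (omega_weight n) N0 ND (fS n n0) g1 fg gf.
have [c c0 cP] := poly_le_expR n k0.
by apply=> [||x]; [exact: omega_weight| |exact: cP].
Qed.

(** The inverse of an element of level n may fall outside that level, but it lies in a later one
    whose exponential rate is at most k. *)
Lemma Ealg_inverse_closed (q : nat -> R) :
  (forall n, (0 < n)%N -> 0 < q n <= 1) ->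
  (forall m n, (0 < m)%N -> (m <= n)%N -> q m <= q n) ->
  inverse_closed (Ealg A N q).
Proof.
move=> q01 q_incr.
have EM m n : (0 < m)%N -> (m <= n)%N ->
    ellp (A := A) (q m) (nu N n) `<=` ellp (q n) (nu N n).
  move=> m0 mn; have /andP[qm0 _] := q01 m m0.
  by apply: ellp_sub => //; [exact: q_incr|exact: nu_weight].
split.
  apply: is_subalgebra_bigcup => [|n n0|m n m0 mn]; first by exists 1%N.
    by apply: ellp_subalgebra; [exact: q01|exact: nu_weight].
  split; first exact: leq_trans mn.
  apply: subset_trans (EM _ _ m0 mn); have /andP[qm0 _] := q01 m m0.
  by apply: ellp_sub => //; [exact: nu_weight|move=> x; exact: nu_le].
move=> f [n n0 fE] [g g1 [fg gf]].
have [k k0 kP] := ellp_inverse (q01 n n0) (nu_weight n) N0 ND fE g1 fg gf.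
(* The second entry of the maximum gives 1 / (m + 1) <= k, and the first gives [nu N m] below
   [nu N n]. *)
exists g => //; pose m := maxn n (Num.truncn k^-1).
have nm : (n <= m)%N by exact: leq_maxl.
exists m; first exact: leq_trans nm.
(* Membership is shown with exponent q n and weight [nu N m]; the inclusion [EM] then raises the
   exponent to q m. *)
apply: (EM n m n0 nm); apply: (kP _ 1) => [|x|x]; first exact: nu_weight.
  exact: nu_le.
rewrite mul1r ler_expR mulrC ler_wpM2r//.
rewrite -[k]invrK lef_pV2 ?posrE ?ltr0n ?invr_gt0//.
apply: (@le_trans _ _ (Num.truncn k^-1).+1%:R).
  by rewrite ltW ?truncnS_gt.
by rewrite ler_nat ltnS leq_maxr.
Qed.

End inverse_closedness.

Theorem theorem5p3 (R : realType) (A : banachAlgType R[i]) (p q : nat -> R)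
    (p_range : forall n, (0 < n)%N -> 0 < p n <= 1)
    (p_decr : forall m n, (0 < m)%N -> (m <= n)%N -> p n <= p m)
    (p_lim : ~ (p @ \oo --> (0 : R)))
    (q_range : forall n, (0 < n)%N -> 0 < q n <= 1)
    (q_incr : forall m n, (0 < m)%N -> (m <= n)%N -> q m <= q n) :
  (forall d : nat, (0 < d)%N ->
     inverse_closed (Salg A (@enorm_fin R d) p) /\
     inverse_closed (Ealg A (@enorm_fin R d) q)) /\
  (inverse_closed (Salg A (@enorm_finseq R) p) /\
   inverse_closed (Ealg A (@enorm_finseq R) q)).
Proof.
have fin0 d (x : 'rV[int]_d) : 0 <= enorm_fin R x by exact: sqrtr_ge0.
have finseq0 (x : int_finseq) : 0 <= enorm_finseq R x by exact: sqrtr_ge0.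
split=> [d _|]; split.
- exact: (Salg_inverse_closed A (@fin0 d) (@enorm_finD R d) p_range).
- exact: (Ealg_inverse_closed A (@fin0 d) (@enorm_finD R d) q_range q_incr).
- exact: (Salg_inverse_closed A finseq0 (@enorm_finseqD R) p_range).
- exact: (Ealg_inverse_closed A finseq0 (@enorm_finseqD R) q_range q_incr).
Qed.
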